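(* Let $G=H[H']\oplus_\phi K[K']$ be an intransitive permutation group without fixed points which has no nontrivial proper normal subgroups. Then the groups $H$ and $K$ are simple and isomorphic as abstract groups, and the groups $H'$ and $K'$ are trivial. In particular, $G$ is the parallel sum $G=H\,||_\phi\,K$ for some isomorphism $\phi$.
   Context: All permutation groups are finite. Let $H\le Sym(\Omega_1)$ and $K\le Sym(\Omega_2)$ be permutation groups on disjoint (nonempty) sets, $H'\lhd H$ and $K'\lhd K$ normal subgroups, and $\phi:H/H'\to K/K'$ an (abstract) isomorphism of the factor groups. The subdirect sum $H[H']\oplus_\phi K[K']$ is the permutation group on the disjoint union $\Omega_1\cup\Omega_2$ consisting of all permutations $(h,k)$ (acting as $h$ on $\Omega_1$ and as $k$ on $\Omega_2$) with $h\in H$, $k\in K$ such that $\phi(H'h)=K'k$. (Every intransitive permutation group can be written in this form, with $H,K$ its restrictions to two complementary nonempty invariant sets $\Omega_1,\Omega_2$, and with $H'$, $K'$ the subgroups fixing pointwise $\Omega_2$ and $\Omega_1$, respectively.) When $H'$ and $K'$ are trivial, $\phi$ is an isomorphism $H\to K$ and the subdirect sum is called the parallel sum and denoted $H\,||_\phi\,K$; it consists of all permutations $(h,\phi(h))$, $h\in H$. *)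

(* Defs.v *)
From HB Require Import structures.
From mathcomp Require Import all_boot all_fingroup all_solvable.

Set Implicit Arguments.
Unset Strict Implicit.
Unset Printing Implicit Defensive.

Import GroupScope.

Section SubdirectSum.

Variables T1 T2 : finType.
Implicit Types (h : {perm T1}) (k : {perm T2}).

(* The disjoint union of the two permutation domains is the sum type T1 + T2. *)
Definition sum_perm_fun h k (x : T1 + T2) : T1 + T2 :=
  match x with inl a => inl (h a) | inr b => inr (k b) end.

Lemma sum_perm_inj h k : injective (sum_perm_fun h k).
Proof. by move=> [a|b] [c|d] //= [] /perm_inj ->. Qed.

Definition sum_perm h k : {perm T1 + T2} := perm (@sum_perm_inj h k).

Lemma sum_permM h1 k1 h2 k2 :
  sum_perm h1 k1 * sum_perm h2 k2 = sum_perm (h1 * h2) (k1 * k2).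
Proof. by apply/permP=> -[a|b]; rewrite permM !permE /= permM. Qed.

Lemma sum_perm1 : sum_perm 1 1 = 1.
Proof. by apply/permP=> -[a|b]; rewrite !permE /= perm1. Qed.

Variables (H H' : {group {perm T1}}) (K K' : {group {perm T2}}).

(* For h in H and H' <| H, coset H' h is the coset of H' containing h. *)
Definition subdirect_sum (phi : {morphism H / H' >-> coset_of K'}) :
    {set {perm T1 + T2}} :=
  [set sum_perm h k | h in H, k in K & phi (coset H' h) == coset K' k].

Definition parallel_sum (phi : {morphism H >-> {perm T2}}) :
    {set {perm T1 + T2}} :=
  [set sum_perm h (phi h) | h in H].

Lemma group_set_subdirect_sum (phi : {morphism H / H' >-> coset_of K'}) :
  H' <| H -> K' <| K -> group_set (subdirect_sum phi).
Proof.
move=> /andP[_ nH] /andP[_ nK]; apply/group_setP; split.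
  apply/imset2P; exists 1 1; rewrite ?group1 ?sum_perm1 //.
  by rewrite inE group1 !morph1 eqxx.
move=> _ _ /imset2P[h1 k1 h1H + ->] /imset2P[h2 k2 h2H + ->].
rewrite !inE => /andP[k1K /eqP e1] /andP[k2K /eqP e2].
rewrite sum_permM; apply/imset2P; exists (h1 * h2) (k1 * k2); rewrite ?groupM //.
rewrite inE groupM //= !morphM ?(subsetP nH) ?(subsetP nK) ?mem_quotient //.
by rewrite e1 e2.
Qed.

End SubdirectSum.

(* Main.v *)
(* The pointwise stabiliser in G of a G-invariant set is normal in G. For each
   of the two summands it is proper because G has no fixed points, hence
   trivial; since these stabilisers contain 1 x K' and H' x 1, both K' and H'
   are trivial. Then phi lifts to an isomorphism psi : H -> K whose graph is G,
   and H, K inherit simplicity from G. *)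
Require Import Defs.
From HB Require Import structures.
From mathcomp Require Import all_boot all_fingroup all_solvable.

Set Implicit Arguments.
Unset Strict Implicit.
Unset Printing Implicit Defensive.

Import GroupScope.

(** By simplicity the pointwise stabiliser, being normal, is [1] or [G]; in the latter case any
    point of the nonempty [S] would be fixed by [G]. *)
Lemma simple_astab_eq1 (T : finType) (G : {group {perm T}}) (S : {set T}) :
    simple G -> [acts G, on S | 'P] -> S != set0 -> 'Fix_('P)(G) = set0 ->
  'C_G(S | 'P) = 1.
Proof.
move=> /simpleP[_ minG] actsGS /set0Pn[x Sx] nofixG.
have nsCG : 'C_G(S | 'P) <| G.
  (* [G] preserves [S] setwise, and the setwise stabiliser normalises the pointwise one. *)
  rewrite /normal subsetIl; apply: normsI (normG G) _.
  exact: subset_trans actsGS (astab_norm _ _).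
case: (minG _ nsCG) => //= defC.
suff: x \in 'Fix_('P)(G) by rewrite nofixG inE.
by rewrite -defC; apply/afixP => g /setIP[_] /astab_act->.
Qed.

Section SumPerm.

Variables T1 T2 : finType.
Implicit Types (h : {perm T1}) (k : {perm T2}).

Lemma sum_permE1 h k a : sum_perm h k (inl a) = inl (h a).
Proof. by rewrite permE. Qed.

Lemma sum_permE2 h k b : sum_perm h k (inr b) = inr (k b).
Proof. by rewrite permE. Qed.

Lemma sum_perm_inj1 h1 h2 k1 k2 : sum_perm h1 k1 = sum_perm h2 k2 -> h1 = h2.
Proof.
move=> /permP eqs; apply/permP => a.
by have := eqs (inl a); rewrite !sum_permE1 => -[].
Qed.

Lemma sum_perm_inj2 h1 h2 k1 k2 : sum_perm h1 k1 = sum_perm h2 k2 -> k1 = k2.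
Proof.
move=> /permP eqs; apply/permP => b.
by have := eqs (inr b); rewrite !sum_permE2 => -[].
Qed.

Variables (H : {group {perm T1}}) (psi : {morphism H >-> {perm T2}}).

Definition parallel_embed h := sum_perm h (psi h).

Lemma parallel_embedM : {in H &, {morph parallel_embed : x y / x * y}}.
Proof. by move=> x y Hx Hy; rewrite /parallel_embed morphM // sum_permM. Qed.

Canonical parallel_embed_morphism := Morphism parallel_embedM.

(** The map [parallel_embed] is injective because its first component already recovers [h]. This is
    how simplicity of [G] reaches [H]. *)
Lemma isog_parallel_sum (G : {group {perm T1 + T2}}) :
  G = parallel_sum psi :> {set _} -> H \isog G.
Proof.
move=> defG; apply/isogP; exists parallel_embed_morphism.
  by apply/injmP => x y _ _ /sum_perm_inj1.
by rewrite morphimEdom defG.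
Qed.

End SumPerm.

Section TrivialKernels.

Variables (T1 T2 : finType) (H H' : {group {perm T1}}).
Variables (K K' : {group {perm T2}}) (phi : {morphism H / H' >-> coset_of K'}).
Hypotheses (nsH'H : H' <| H) (nsK'K : K' <| K).
Hypothesis isophi : isom (H / H') (K / K') phi.

(** With trivial kernels both coset maps are injective, so [phi] conjugated by them is an
    isomorphism from [H] to [K]. *)
Lemma subdirect_sum_trivial_parallel :
    H' = 1 :> {set _} -> K' = 1 :> {set _} ->
  exists psi : {morphism H >-> {perm T2}},
    isom H K psi /\ subdirect_sum K phi = parallel_sum psi.
Proof.
move=> H'1 K'1; have [nH nK] := (normal_norm nsH'H, normal_norm nsK'K).
have [injphi imphi] := isomP isophi.
have injH : {in H &, injective (coset H')}.
  move=> x y /(subsetP nH) nHx /(subsetP nH) nHy; apply: (injmP _) nHx nHy.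
  by rewrite ker_coset H'1.
(* Restricting to [K] makes the image exactly [K / K'], so that the inverse takes its values in
   [K]. *)
have injK : 'injm (restrm nK (coset K')).
  by rewrite ker_restrm ker_coset K'1 setIg1.
pose psi h := invm injK (phi (coset H' h)).
have phiH h : h \in H -> phi (coset H' h) \in restrm nK (coset K') @* K.
  by move=> Hh; rewrite im_restrm -/(K / K') -imphi
    mem_morphim ?mem_quotient.
have Kpsi h : h \in H -> psi h \in K.
  move=> /phiH Qh; have := mem_morphim (invm_morphism injK) Qh Qh.
  by rewrite im_invm.
have psiE h : h \in H -> coset K' (psi h) = phi (coset H' h).
  by move=> Hh; apply: (invmK injK); apply: phiH.
(* The condition defining the subdirect sum forces [k = psi h]; multiplicativity, surjectivity and
   the equality of the two sums all follow from this. *)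
have psi_uniq h k : h \in H -> k \in K -> phi (coset H' h) = coset K' k ->
    psi h = k.
  by move=> Hh Kk phih; rewrite /psi phih; apply: (invmE injK).
have psiM : {in H &, {morph psi : x y / x * y}}.
  move=> x y Hx Hy; apply: psi_uniq; rewrite ?groupM ?Kpsi //.
  by rewrite !morphM ?(subsetP nH) ?(subsetP nK) ?mem_quotient ?Kpsi //= !psiE.
exists (Morphism psiM); split.
  apply/isomP; split.
    apply/injmP => x y Hx Hy /= eq_psi; apply: injH => //.
    by apply: (injmP injphi); rewrite ?mem_quotient // -!psiE // eq_psi.
  apply/eqP; rewrite eqEsubset; apply/andP; split.
    by apply/subsetP => _ /morphimP[h _ Hh ->]; apply: Kpsi.
  apply/subsetP => k Kk; have := mem_quotient K' Kk.
  rewrite -imphi => /morphimP[_ _ /morphimP[h nHh Hh ->] phih].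
  by apply/morphimP; exists h; rewrite //= (psi_uniq h k).
apply/setP => g; apply/imset2P/imsetP => [[h k Hh] | [h Hh ->]].
  by rewrite inE => /andP[Kk /eqP phih] ->; exists h; rewrite //= (psi_uniq h k).
by exists h (psi h); rewrite // inE Kpsi ?psiE //=.
Qed.

End TrivialKernels.

Theorem proposition5p1 (T1 T2 : finType)
    (T1_gt0 : 0 < #|T1|) (T2_gt0 : 0 < #|T2|)
    (H H' : {group {perm T1}}) (K K' : {group {perm T2}})
    (nsH'H : H' <| H) (nsK'K : K' <| K)
    (phi : {morphism H / H' >-> coset_of K'})
    (isophi : isom (H / H') (K / K') phi)
    (G : {group {perm T1 + T2}})
    (defG : G = subdirect_sum K phi :> {set {perm T1 + T2}})
    (intransG : ~~ [transitive G, on [set: T1 + T2] | 'P])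
    (nofixG : 'Fix_('P)(G) = set0)
    (minG : forall N : {group {perm T1 + T2}},
       N <| G -> N = 1 :> {set _} \/ N = G :> {set _}) :
  [/\ simple H, simple K & H \isog K] /\
  (H' = 1 :> {set _} /\ K' = 1 :> {set _}) /\
  exists psi : {morphism H >-> {perm T2}},
    isom H K psi /\ G = parallel_sum psi :> {set {perm T1 + T2}}.
Proof.
have inG h k : h \in H -> k \in K -> phi (coset H' h) = coset K' k ->
    sum_perm h k \in G.
  move=> Hh Kk phih; rewrite defG; apply/imset2P; exists h k => //.
  by rewrite inE Kk phih /=.
(* [simple] demands nontriviality, which [minG] does not give; the trivial group would fix every
   point. *)
have ntG : G != 1 :> {set _}.
  apply/eqP => G1; have /card_gt0P[a _] := T1_gt0.
  suff: inl a \in 'Fix_('P)(G) by rewrite nofixG inE.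
  by rewrite G1; apply/afixP => g /set1P->; rewrite act1.
have simG : simple G by apply/simpleP.
have actsG (S : {set T1 + T2}) :
    (forall h k x, x \in S -> sum_perm h k x \in S) -> [acts G, on S | 'P].
  move=> stabS; apply/subsetP => g; rewrite defG.
  case/imset2P=> h k _ _ ->; rewrite !inE; apply/subsetP => x Sx.
  by rewrite inE; apply: stabS.
have K'1 : K' = 1 :> {set _}.
  pose S : {set T1 + T2} := [set inl a | a in [set: T1]].
  have CS : 'C_G(S | 'P) = 1.
    apply: simple_astab_eq1 => //.
      apply: actsG => h k _ /imsetP[a _ ->].
      by rewrite sum_permE1 imset_f.
    have /card_gt0P[a _] := T1_gt0.
    by apply/set0Pn; exists (inl a); rewrite imset_f.
  apply/trivgP/subsetP => k K'k; have Kk := subsetP (normal_sub nsK'K) k K'k.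
  (* Both [1] and [k] lie in trivial cosets, which [phi] matches, so the pair is in [G]; it fixes
     the [T1] summand pointwise. *)
  have: sum_perm 1 k \in 'C_G(S | 'P).
    rewrite inE inG ?group1 ?morph1 ?coset_id //=.
    by apply/astabP => _ /imsetP[a _ ->] /=; rewrite apermE sum_permE1 perm1.
  by rewrite CS => /set1P; rewrite -sum_perm1 => /sum_perm_inj2->; apply: set11.
(* Symmetric argument, with the stabiliser of the [T2] summand. *)
have H'1 : H' = 1 :> {set _}.
  pose S : {set T1 + T2} := [set inr b | b in [set: T2]].
  have CS : 'C_G(S | 'P) = 1.
    apply: simple_astab_eq1 => //.
      apply: actsG => h k _ /imsetP[b _ ->].
      by rewrite sum_permE2 imset_f.
    have /card_gt0P[b _] := T2_gt0.
    by apply/set0Pn; exists (inr b); rewrite imset_f.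
  apply/trivgP/subsetP => h H'h; have Hh := subsetP (normal_sub nsH'H) h H'h.
  have: sum_perm h 1 \in 'C_G(S | 'P).
    rewrite inE inG ?group1 ?coset_id ?morph1 //=.
    by apply/astabP => _ /imsetP[b _ ->] /=; rewrite apermE sum_permE2 perm1.
  by rewrite CS => /set1P; rewrite -sum_perm1 => /sum_perm_inj1->; apply: set11.
have [psi [isopsi sumE]] :=
  subdirect_sum_trivial_parallel nsH'H nsK'K isophi H'1 K'1.
have defGpsi : G = parallel_sum psi :> {set _} by rewrite defG.
have isoHG := isog_parallel_sum defGpsi.
have isoHK := isom_isog psi (subxx H) isopsi.
have simH : simple H by rewrite (isog_simple isoHG).
split; [split=> // | by split; last exists psi].
by rewrite -(isog_simple isoHK).
Qed.
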